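(* Let $\bar H:G\times\mathfrak g^*\to\mathbb R$ be a Hamiltonian function and let $X_{\bar H}$ be the Hamiltonian vector field on $(G\times\mathfrak g^*,\Omega)$ defined by $i_{X_{\bar H}}\Omega=-d\bar H$. Then $X_{\bar H}$ at $(g,\mu)$ is generated by the element $$\left(\frac{\delta\bar H}{\delta\mu},\,-T_e^*R_g\frac{\delta\bar H}{\delta g}\right)\in\mathfrak g\times\mathfrak g^*,$$ i.e. $X_{\bar H}(g,\mu)=X_{(\xi,\nu)}(g,\mu)$ with $\xi=\delta\bar H/\delta\mu$ and $\nu=-T_e^*R_g(\delta\bar H/\delta g)$, and the components of $X_{\bar H}$ are given by the trivialized Hamilton's equations $$\frac{dg}{dt}=T_eR_g\left(\frac{\delta\bar H}{\delta\mu}\right),\qquad \frac{d\mu}{dt}=ad^*_{\frac{\delta\bar H}{\delta\mu}}\mu-T_e^*R_g\frac{\delta\bar H}{\delta g}.$$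
   Context: $G$ is a Lie group with identity $e$, and $\mathfrak g\simeq T_eG$ is its Lie algebra, assumed reflexive ($\mathfrak g^{**}=\mathfrak g$), with dual $\mathfrak g^*$. $R_g$ is right multiplication. The bracket on $\mathfrak g$ is the one of right invariant vector fields: $X^G_{[\xi,\eta]}=[X^G_\xi,X^G_\eta]_{JL}$ (Jacobi-Lie bracket), where $X_\xi^G(g)=T_eR_g\xi$. $ad^*_\xi$ is given by $\langle ad^*_\xi\mu,\eta\rangle=\langle\mu,[\xi,\eta]\rangle$. $T_e^*R_g:T_g^*G\to\mathfrak g^*$ is the dual of $T_eR_g$. $\delta\bar H/\delta g\in T_g^*G$ and $\delta\bar H/\delta\mu\in\mathfrak g^{**}=\mathfrak g$ are the partial derivatives of $\bar H(g,\mu)$. $G\times\mathfrak g^*$ (written $G\circledS\mathfrak g^*$ with its semidirect product group structure) is identified with $T^*G$ by the right trivialization $\alpha_g\mapsto(g,T_e^*R_g\alpha_g)$. For $(\xi,\nu)\in\mathfrak g\times\mathfrak g^*$ (the Lie algebra of $G\circledS\mathfrak g^*$) the right invariant vector field it generates is $$X_{(\xi,\nu)}(g,\mu)=(T_eR_g\xi,\ \nu+ad^*_\xi\mu)\in T_gG\times\mathfrak g^*.$$ The symplectic two-form $\Omega=\Omega_{G\circledS\mathfrak g^*}$ on $G\times\mathfrak g^*$ is the push-forward of the canonical symplectic form of $T^*G$ under the trivialization, and is determined by its values $$\Omega(X_{(\xi,\nu)},X_{(\eta,\lambda)})(g,\mu)=\langle\nu,\eta\rangle-\langle\lambda,\xi\rangle+\langle\mu,[\xi,\eta]\rangle.$$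 *)

(* Defs.v *)
From HB Require Import structures.
From mathcomp Require Import all_boot all_order all_algebra.
From mathcomp Require Import all_classical all_reals all_analysis.

Set Implicit Arguments.
Unset Strict Implicit.
Unset Printing Implicit Defensive.

Import Order.TTheory GRing.Theory Num.Theory.
Import numFieldNormedType.Exports.

Local Open Scope classical_set_scope.
Local Open Scope ring_scope.

Section ContinuousLinearMaps.
Context {R : realType} (E F : normedModType R).

Definition clin_pred : {pred E -> F} :=
  mem [set f : E -> F | linear f /\ continuous f].

Record clin := Clin { clin_fun :> E -> F; clin_funP : clin_fun \in clin_pred }.

HB.instance Definition _ := [isSub for clin_fun].
HB.instance Definition _ := [Choice of clin by <:].

Lemma clin_submod : submod_closed clin_pred.
Proof.
split=> [|a f g].
  rewrite inE; split=> [b u v|x]; last exact: cst_continuous.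
  by rewrite /= -[RHS]/(b *: 0 + 0) scaler0 addr0.
rewrite !inE => -[lf cf] [lg cg]; split=> [b u v|x].
  rewrite -[LHS]/(a *: f _ + g _) -[RHS]/(b *: (a *: f u + g u) + (a *: f v + g v)).
  rewrite lf lg !scalerDr !scalerA [a * b]mulrC.
  by rewrite -!addrA; congr (_ + _); rewrite addrCA.
by apply: cvgD; [apply: cvgZr; exact: cf|exact: cg].
Qed.

HB.instance Definition _ :=
  GRing.isSubmodClosed.Build R (E -> F) clin_pred clin_submod.
HB.instance Definition _ := [SubChoice_isSubLmodule of clin by <:].

Lemma clin_linear (f : clin) : linear f.
Proof. by have := clin_funP f; rewrite inE => -[]. Qed.

Lemma clin_continuous (f : clin) : continuous f.
Proof. by have := clin_funP f; rewrite inE => -[]. Qed.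

HB.instance Definition _ (f : clin) :=
  GRing.isLinear.Build R E F *:%R f (clin_linear f).

Let unit_values (f : clin) : set R := [set `|f x| | x in [set x | `|x| <= 1]].

Definition opnorm (f : clin) : R := sup (unit_values f).

Lemma opnorm_bounded (f : clin) : has_ubound (unit_values f).
Proof.
have /linear_boundedP/pinfty_ex_gt0[r r0 fr] : bounded_near f (nbhs (0 : E)).
  by apply/linear_bounded_continuous; exact: clin_continuous.
exists r => _ [x /= x1 <-]; rewrite (le_trans (fr x))//.
by rewrite ler_piMr// ltW.
Qed.

Lemma opnorm_ge (f : clin) x : `|x| <= 1 -> `|f x| <= opnorm f.
Proof. by move=> x1; apply: ub_le_sup; [exact: opnorm_bounded|exists x]. Qed.

Lemma opnorm_le (f : clin) (r : R) :
  (forall x, `|x| <= 1 -> `|f x| <= r) -> opnorm f <= r.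
Proof.
move=> fr; apply: ge_sup; first by exists `|f 0|, 0 => //=; rewrite normr0.
by move=> _ [x /= x1 <-]; exact: fr.
Qed.

Lemma opnorm_ge0 (f : clin) : 0 <= opnorm f.
Proof. by rewrite (le_trans _ (@opnorm_ge f 0 _))// normr0. Qed.

Lemma clin_norm_le (f : clin) x : `|f x| <= opnorm f * `|x|.
Proof.
have [->|x0] := eqVneq x 0; first by rewrite linear0 !normr0 mulr0.
have x_gt0 : 0 < `|x| by rewrite normr_gt0.
rewrite -ler_pdivrMr// -[X in _ / X]normr_id mulrC -normfV -normrZ -linearZ.
by apply: opnorm_ge; rewrite normrZ normfV normr_id mulVf// gt_eqF.
Qed.

Let opnormD (f g : clin) : opnorm (f + g) <= opnorm f + opnorm g.
Proof.
apply: opnorm_le => x x1; rewrite -[(f + g) x]/(f x + g x).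
by rewrite (le_trans (ler_normD _ _))// lerD// opnorm_ge.
Qed.

Let opnormZ_le (l : R) (f : clin) : opnorm (l *: f) <= `|l| * opnorm f.
Proof.
apply: opnorm_le => x x1; rewrite -[(l *: f) x]/(l *: f x).
by rewrite normrZ ler_wpM2l// opnorm_ge.
Qed.

Let opnormZ (l : R) (f : clin) : opnorm (l *: f) = `|l| * opnorm f.
Proof.
have [->|l0] := eqVneq l 0.
  apply/eqP; rewrite normr0 mul0r eq_le opnorm_ge0 andbT.
  by rewrite (le_trans (opnormZ_le _ _))// normr0 mul0r.
apply/eqP; rewrite eq_le opnormZ_le/=.
rewrite mulrC -ler_pdivlMr ?normr_gt0// mulrC -normfV.
by rewrite (le_trans _ (opnormZ_le _ _))// scalerA mulVf// scale1r.
Qed.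

Let opnorm0_eq0 (f : clin) : opnorm f = 0 -> f = 0.
Proof.
move=> f0; apply/val_inj/funext => x /=; apply/eqP.
by rewrite -normr_le0 (le_trans (clin_norm_le f x))// f0 mul0r.
Qed.

HB.instance Definition _ :=
  Lmodule_isNormed.Build R clin opnormD opnormZ opnorm0_eq0.

(* The element of [clin] with underlying function [f], or 0 when [f] is not
   both linear and continuous. *)
Definition to_clin (f : E -> F) : clin := insubd 0 f.

End ContinuousLinearMaps.

Definition dual {R : realType} (E : normedModType R) : normedModType R :=
  clin E R^o.

Definition pairing {R : realType} (E : normedModType R) (mu : dual E) (xi : E) :
  R := (mu : clin E R^o) xi.

(* The functional E -> R as an element of E*, when it is linear and
   continuous. *)
Definition to_dual {R : realType} (E : normedModType R) (f : E -> R) : dual E :=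
  to_clin (f : E -> R^o).

Section Reflexivity.
Context {R : realType} (E : normedModType R).

Definition eval_bidual (xi : E) : dual (dual E) :=
  to_dual (fun mu : dual E => pairing mu xi).

Definition reflexive_space : Prop := bijective eval_bidual.

(* The identification of E** with E: for a reflexive E, [of_bidual] is the
   inverse of [eval_bidual]. *)
Definition of_bidual (Phi : dual (dual E)) : E :=
  get [set xi | eval_bidual xi = Phi].

End Reflexivity.

(* C^n and C^oo maps on an open set U, the derivative being a map into the
   space of continuous linear maps with the operator norm. *)
Fixpoint Ck_on {R : realType} (n : nat) (E F : normedModType R) (U : set E)
    (f : E -> F) : Prop :=
  if n is m.+1 then
    (forall x, U x -> differentiable f x) /\
    Ck_on m U (fun x => to_clin ('d f x))
  else forall x, U x -> {for x, continuous f}.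

Definition smooth_on {R : realType} (E F : normedModType R) (U : set E)
    (f : E -> F) : Prop :=
  forall n, Ck_on n U f.

(* An atlas on M modelled on E, indexed by the points of M: [chart C p] is the
   chart around p, defined on [chart_dom C p], and [chart_inv C p] is its
   inverse; both are total functions, with irrelevant values elsewhere. *)
Record atlas {R : realType} (E : normedModType R) (M : Type) := Atlas {
  chart_dom : M -> set M;
  chart : M -> M -> E;
  chart_inv : M -> E -> M }.

Record smooth_manifold {R : realType} (E : normedModType R)
    (M : topologicalType) (C : atlas E M) : Prop := SmoothManifold {
  chart_dom_refl : forall p, chart_dom C p p;
  chart_dom_open : forall p, open (chart_dom C p);
  chart_img_open : forall p, open (chart C p @` chart_dom C p);
  chartK : forall p q, chart_dom C p q -> chart_inv C p (chart C p q) = q;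
  chart_continuous : forall p q,
    chart_dom C p q -> {for q, continuous (chart C p)};
  chart_inv_continuous : forall p x,
    (chart C p @` chart_dom C p) x -> {for x, continuous (chart_inv C p)};
  chart_compatible : forall p q,
    smooth_on (chart C p @` (chart_dom C p `&` chart_dom C q))
              (chart C q \o chart_inv C p) }.

Definition model_atlas {R : realType} (E : normedModType R) : atlas E E :=
  Atlas (fun=> setT) (fun=> id) (fun=> id).

Definition prod_atlas {R : realType} (E F : normedModType R) (M N : Type)
    (C : atlas E M) (D : atlas F N) : atlas (E * F)%type (M * N)%type :=
  Atlas (fun p => chart_dom C p.1 `*` chart_dom D p.2)
        (fun p q => (chart C p.1 q.1, chart D p.2 q.2))
        (fun p x => (chart_inv C p.1 x.1, chart_inv D p.2 x.2)).

Definition smooth_map {R : realType} (E F : normedModType R)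
    (M N : topologicalType) (C : atlas E M) (D : atlas F N) (f : M -> N) : Prop :=
  continuous f /\
  forall p, smooth_on
    (chart C p @` (chart_dom C p `&` f @^-1` chart_dom D (f p)))
    (chart D (f p) \o f \o chart_inv C p).

(* T_p M is a copy of E: a tangent vector at p is given by its coordinates in
   the chart around p. *)
Definition tangent {R : realType} {E : normedModType R} {M : Type}
  (C : atlas E M) (p : M) : normedModType R := E.

Definition cotangent {R : realType} {E : normedModType R} {M : Type}
  (C : atlas E M) (p : M) : normedModType R := dual (tangent C p).

Definition tangent_map {R : realType} {E F : normedModType R} {M N : Type}
    (C : atlas E M) (D : atlas F N) (f : M -> N) (p : M) (v : tangent C p) :
    tangent D (f p) :=
  'd (chart D (f p) \o f \o chart_inv C p) (chart C p p) v.

Arguments tangent_map {R E F M N} C D f p v.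

Definition two_form {R : realType} {E : normedModType R} {M : Type}
  (C : atlas E M) := forall p, tangent C p -> tangent C p -> R.

(* Omega = f_* omega, for a diffeomorphism f. *)
Definition is_pushforward {R : realType} {E F : normedModType R} {M N : Type}
    (C : atlas E M) (D : atlas F N) (f : M -> N) (omega : two_form C)
    (Omega : two_form D) : Prop :=
  forall (p : M) (V W : tangent C p),
    Omega (f p) (tangent_map C D f p V) (tangent_map C D f p W) = omega p V W.

Section Tangent.
Context {R : realType} {E : normedModType R} {M : Type}.
Implicit Type C : atlas E M.

Definition differential C (f : M -> R) (p : M) : cotangent C p :=
  to_dual (tangent_map C (model_atlas R^o) (f : M -> R^o) p).

Definition vector_field C := forall p, tangent C p.

(* The principal part of X in the chart around p. *)
Definition local_rep C (X : vector_field C) (p : M) (x : E) : E :=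
  let q := chart_inv C p x in
  tangent_map C (model_atlas E) (chart C p) q (X q).

(* [X, Y]^i = X^j d_j Y^i - Y^j d_j X^i. *)
Definition jacobi_lie C (X Y : vector_field C) : vector_field C :=
  fun p => 'd (local_rep Y p) (chart C p p) (X p)
         - 'd (local_rep X p) (chart C p p) (Y p).

(* i_X Omega = - dH. *)
Definition is_hamiltonian C (Omega : two_form C) (H : M -> R)
    (X : vector_field C) : Prop :=
  forall (p : M) (W : tangent C p),
    Omega p (X p) W = - pairing (differential C H p) W.

End Tangent.

Definition has_velocity {R : realType} {E : normedModType R}
    {M : topologicalType} (C : atlas E M) (c : R -> M) (t : R)
    (v : tangent C (c t)) : Prop :=
  {for t, continuous c} /\
  is_derive (t : R^o) (1 : R^o) (chart C (c t) \o c : R^o -> E) v.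

Arguments has_velocity {R E M} C c t v.

(* T*M: the pair (p, mu) is the covector at p with coordinates mu in the chart
   around p. *)
Definition cotangent_bundle {R : realType} {E : normedModType R} {M : Type}
  (C : atlas E M) : Type := (M * dual E)%type.

Section CotangentBundle.
Context {R : realType} {E : normedModType R} {M : Type} (C : atlas E M).

(* The natural charts of T*M induced by the charts of M: the fibre component of
   [chart _ a b] is the covector b.2 at b.1 in the chart of M around a.1. *)
Definition cotangent_atlas : atlas (E * dual E)%type (cotangent_bundle C) :=
  Atlas
    (fun a => chart_dom C a.1 `*` setT)
    (fun a b => (chart C a.1 b.1,
       to_dual (fun v => pairing b.2
         ('d (chart C b.1 \o chart_inv C a.1) (chart C a.1 b.1) v))))
    (fun a x => let q := chart_inv C a.1 x.1 in
      (q, to_dual (fun v => pairing x.2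
            ('d (chart C a.1 \o chart_inv C q) (chart C q q) v)))).

(* dp /\ dq in natural charts; this is the sign for which i_X Omega = - dH gives
   dq/dt = dH/dp, dp/dt = - dH/dq. *)
Definition canonical_form : two_form cotangent_atlas :=
  fun a (V W : E * dual E) => pairing V.2 W.1 - pairing W.2 V.1.

End CotangentBundle.

Arguments canonical_form {R E M} C p _ _ : rename.

(* Lie groups modelled on E. *)
HB.mixin Record isLieGroup (R : realType) (E : normedModType R) G
    of Topological G & Group G := {
  lie_atlas : atlas E G;
  lie_manifold : smooth_manifold lie_atlas;
  mulg_smooth : smooth_map (prod_atlas lie_atlas lie_atlas) lie_atlas
    (fun p : G * G => (p.1 * p.2)%g);
  invg_smooth : smooth_map lie_atlas lie_atlas (fun g : G => (g^-1)%g) }.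

#[short(type="lieGroupType")]
HB.structure Definition LieGroup (R : realType) (E : normedModType R) :=
  {G of isLieGroup R E G & Topological G & Group G}.

Section LieGroupTheory.
Context {R : realType} {E : normedModType R} (G : lieGroupType E).

Local Notation A := (lie_atlas : atlas E G).

(* The vector space T_e G; its bracket is [lie_bracket] below. *)
Definition lie_algebra : normedModType R := tangent A 1%g.

Local Notation g_ := lie_algebra.

Definition rmul (g h : G) : G := (h * g)%g.

(* [rmul g 1] is 1 * g: the value is read in the chart around 1 * g = g. *)
Definition TeR (g : G) (xi : g_) : tangent A g :=
  tangent_map A A (rmul g) 1%g xi.

Definition TeR_dual (g : G) (alpha : cotangent A g) : dual g_ :=
  to_dual (fun xi => pairing alpha (TeR g xi)).

Definition right_inv_field (xi : g_) : vector_field A := fun g => TeR g xi.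

(* The value at e of the Jacobi-Lie bracket of right invariant vector fields. *)
Definition lie_bracket (xi eta : g_) : g_ :=
  jacobi_lie (right_inv_field xi) (right_inv_field eta) 1%g.

Definition ad_star (xi : g_) (mu : dual g_) : dual g_ :=
  to_dual (fun eta => pairing mu (lie_bracket xi eta)).

Definition triv_atlas : atlas (E * dual g_)%type (G * dual g_)%type :=
  prod_atlas A (model_atlas (dual g_)).

Definition right_triv (a : cotangent_bundle A) : (G * dual g_)%type :=
  (a.1, TeR_dual (g := a.1) a.2).

(* The right invariant vector field X_(xi, nu). *)
Definition triv_right_inv_field (xi : g_) (nu : dual g_) :
    vector_field triv_atlas :=
  fun z => (TeR z.1 xi, nu + ad_star xi z.2).

Definition partial_g (H : G * dual g_ -> R) (g : G) (mu : dual g_) :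
    cotangent A g :=
  differential A (fun h => H (h, mu)) g.

(* The derivative in mu lies in g**, and is read in g by reflexivity. *)
Definition partial_mu (H : G * dual g_ -> R) (g : G) (mu : dual g_) : g_ :=
  of_bidual (differential (model_atlas (dual g_)) (fun nu => H (g, nu)) mu).

End LieGroupTheory.

Arguments right_triv {R E} G a.

(* Main.v *)
Require Import Defs.
From HB Require Import structures.
From mathcomp Require Import all_boot all_order all_algebra.
From mathcomp Require Import all_classical all_reals all_analysis.
From mathcomp Require Import ring.
Import Order.TTheory GRing.Theory Num.Theory.
Import numFieldNormedType.Exports.

Set Implicit Arguments.
Unset Strict Implicit.
Unset Printing Implicit Defensive.

Local Open Scope classical_set_scope.
Local Open Scope ring_scope.

(** Read in the chart around g, with x0 the coordinates of g, the right
trivialization of the cotangent bundle is the map F (x, p) = (x, p o B x),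
where B x is the tangent at e of the right translation by the point with
coordinates x ([frame] below), so that x |-> B x xi is the right invariant vector
field generated by xi. Its derivative at (x0, alpha) sends (v, nu) to
(v, alpha o DB v + nu o B x0) ([tangent_right_triv]), and B x0 is invertible,
since right translations are diffeomorphisms ([TeR_bijective]). Hence every
point of G x g* and every tangent vector there comes from T*G, and the
hypothesis on Omega determines it. With mu = alpha o B x0, the terms in which
DB occurs add up to - alpha (DB (B x0 xi) eta - DB (B x0 eta) xi). Up to the
sign, this is the Jacobi-Lie bracket at g of the right invariant fields of xi
and eta, paired with alpha, and right invariance of that bracket turns it into mu [xi, eta]
([dframe_bracket]). Therefore ([symplectic_formE])

  Omega ((T_e R_g xi, sigma), (T_e R_g eta, tau))
    = sigma eta - tau xi - mu [xi, eta]      at (g, mu).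

In the equation i_X Omega = - dH at (g, mu), with
X (g, mu) = (T_e R_g xi, sigma), the test vectors (0, tau) say that the
derivative of H in mu is evaluation at xi, so xi is that derivative read in g
by reflexivity, and the test vectors (T_e R_g eta, 0) give
sigma = ad*_xi mu - T_e* R_g (dH / dg) ([hamiltonian_fieldE]). The equations
for an integral curve are the two components of X.

Right invariance of the bracket comes from differentiating
B (psi y) = D psi y o B_e y, where psi is right translation by g read in charts
and B_e is the frame around e: the defect is the second derivative of psi,
which antisymmetrization kills. As it is only needed after applying the
functional alpha, the symmetry of second derivatives is proved for real-valued
functions ([schwarz]), by the mean value theorem. *)

(** * Calculus with continuous linear maps *)

(** Locked so that unification does not compare different composites through the
insubd in to_clin. *)
HB.lock Definition clin_comp {R : realType} {E F K : normedModType R}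
  (g : clin F K) (f : clin E F) : clin E K := to_clin (g \o f).

Section ClinCalculus.
Context {R : realType}.
Implicit Types E F K V : normedModType R.

Lemma to_clinE E F (f : E -> F) x : linear f -> continuous f -> to_clin f x = f x.
Proof.
by move=> lf cf; rewrite /to_clin; congr (_ x); apply: insubdK; rewrite inE.
Qed.

Lemma clinP E F (f g : clin E F) : (forall x, f x = g x) -> f = g.
Proof. by move=> fg; apply/val_inj/funext. Qed.

Lemma clinDE E F (f g : clin E F) x : (f + g) x = f x + g x. Proof. by []. Qed.
Lemma clinNE E F (f : clin E F) x : (- f) x = - f x. Proof. by []. Qed.
Lemma clinZE E F (c : R) (f : clin E F) x : (c *: f) x = c *: f x.
Proof. by []. Qed.

Lemma to_clin_diffE E F (f : E -> F) x v : differentiable f x ->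
  to_clin ('d f x) v = 'd f x v.
Proof.
by move=> df; rewrite to_clinE//; [exact: linearP|exact: diff_continuous].
Qed.

Lemma clin_compE E F K (g : clin F K) (f : clin E F) x :
  clin_comp g f x = g (f x).
Proof.
rewrite unlock to_clinE//; first by move=> a u v /=; rewrite !linearP.
by move=> u; apply: continuous_comp; exact: clin_continuous.
Qed.

Lemma clin_comp_bilinear E F K : bilinear_for
    (GRing.Scale.Law.clone _ _ *:%R _) (GRing.Scale.Law.clone _ _ *:%R _)
    (@clin_comp R E F K).
Proof.
split=> [f a g h|g a f h]; apply: clinP => x; rewrite clin_compE.
  rewrite -[LHS]/(a *: g (f x) + h (f x)).
  by rewrite -[RHS]/(a *: clin_comp g f x + clin_comp h f x) !clin_compE.
rewrite -[X in g X]/(a *: f x + h x) linearP.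
by rewrite -[RHS]/(a *: clin_comp g f x + clin_comp g h x) !clin_compE.
Qed.

HB.instance Definition _ E F K := bilinear_isBilinear.Build R
  (clin F K) (clin E F) (clin E K) _ _ (@clin_comp R E F K)
  (@clin_comp_bilinear E F K).

Lemma clin_eval_linear E F (x : E) : linear (fun f : clin E F => f x).
Proof. by []. Qed.

Lemma clin_eval_continuous E F (x : E) : continuous (fun f : clin E F => f x).
Proof.
have evM := GRing.isLinear.Build _ _ _ _ _ (@clin_eval_linear E F x).
pose ev : {linear clin E F -> F} := HB.pack (fun f : clin E F => f x) evM.
suff : continuous ev by [].
apply/bounded_linear_continuous/linear_boundedP.
exists `|x|; split; first exact: normr_real.
move=> r xr f; rewrite (le_trans (clin_norm_le f x))// mulrC.
by rewrite ler_wpM2r ?opnorm_ge0// ltW.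
Qed.

Lemma opnorm_comp E F K (g : clin F K) (f : clin E F) :
  `|clin_comp g f| <= `|g| * `|f|.
Proof.
apply: opnorm_le => x x1; rewrite clin_compE.
apply: (le_trans (clin_norm_le _ _)); rewrite ler_wpM2l ?opnorm_ge0//.
exact: opnorm_ge.
Qed.

Lemma clin_comp_continuous E F K :
  continuous (fun p : clin F K * clin E F => clin_comp p.1 p.2).
Proof.
move=> p; apply/cvgrPdist_le => /= _/posnumP[e].
pose b (q : clin F K * clin E F) :=
  `|p.1 - q.1| * `|p.2| + `|q.1| * `|p.2 - q.2|.
have b0 : b q @[q --> p] --> (0 : R).
  rewrite [X in _ --> X](_ : _ = `|p.1 - p.1| * `|p.2| + `|p.1| * `|p.2 - p.2|).
    apply: cvgD; apply: cvgM.
    - by apply: cvg_norm; apply: cvgB; [exact: cvg_cst|exact: cvg_fst].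
    - exact: cvg_cst.
    - by apply: cvg_norm; exact: cvg_fst.
    - by apply: cvg_norm; apply: cvgB; [exact: cvg_cst|exact: cvg_snd].
  by rewrite !subrr !normr0 mul0r mulr0 addr0.
near=> q.
have -> : clin_comp p.1 p.2 - clin_comp q.1 q.2 =
    clin_comp (p.1 - q.1) p.2 + clin_comp q.1 (p.2 - q.2).
  by rewrite linearBr linearBl addrA subrK.
apply: (@le_trans _ _ (b q)).
  by rewrite (le_trans (ler_normD _ _))// lerD// opnorm_comp.
near: q; have /cvgr0_norm_le/(_ e%:num (gt0 _)) := b0.
by apply: filterS => q; apply: le_trans; exact: ler_norm.
Unshelve. all: by end_near. Qed.

Lemma is_diff_clin_comp V E F K (g dg : V -> clin F K) (f df : V -> clin E F) x :
  is_diff x g dg -> is_diff x f df ->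
  is_diff x (fun v => clin_comp (g v) (f v))
    (fun v => clin_comp (g x) (df v) + clin_comp (dg v) (f x)).
Proof.
move=> hg hf; pose b : {bilinear clin F K -> clin E F -> clin E K} := @clin_comp R E F K.
have hb : is_diff (g x, f x) (fun p => clin_comp p.1 p.2)
    (fun q => clin_comp (g x) q.2 + clin_comp q.1 (f x)).
  apply: DiffDef.
    exact: (@differentiable_bilin _ _ _ _ b (g x, f x) (@clin_comp_continuous E F K)).
  exact: (@diff_bilin _ _ _ _ b (g x, f x) (@clin_comp_continuous E F K)).
exact: (@is_diff_comp _ _ _ _ _ _ _ _ _ (is_diff_pair hg hf) hb).
Qed.

Lemma is_diff_eps E F (f : E -> F) (df : {linear E -> F}) x : continuous df ->
  (forall e : R, 0 < e ->
    \forall h \near (0 : E), `|f (h + x) - f x - df h| <= e * `|h|) ->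
  is_diff x f df.
Proof.
move=> dfc fe.
have fo : f \o shift x = cst (f x) + df +o_ (0 : E) id.
  apply/eqaddoP => e e0; have := fe e e0; apply: filterS => h.
  by rewrite opprD addrA.
by split; [apply/diff_locallyP|]; rewrite (diff_unique dfc fo).
Qed.

Lemma diff_eps E F (f : E -> F) x : differentiable f x ->
  forall e : R, 0 < e ->
    \forall h \near (0 : E), `|f (h + x) - f x - 'd f x h| <= e * `|h|.
Proof.
move=> /diff_locallyP[_ /eqaddoP fo] e e0; have := fo e e0; apply: filterS => h.
by rewrite opprD addrA.
Qed.

(** The differential is obtained by choice from the whole function, so that it
depends only on the germ at x needs the epsilon characterization. *)
Lemma is_diff_near_eq E F (f g df : E -> F) x :
  (\forall y \near x, f y = g y) -> is_diff x f df -> is_diff x g df.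
Proof.
move=> fg [dif <-]; apply: is_diff_eps => [|e e0]; first exact: diff_continuous.
have fg0 : \forall h \near (0 : E), f (h + x) = g (h + x).
  rewrite [\forall h \near _, _ = _](near_shift x) sub0r; near=> h.
  by rewrite /= subrK; near: h.
apply: filterS2 fg0 (diff_eps dif e0) => h <-.
by rewrite (nbhs_singleton fg).
Unshelve. all: by end_near. Qed.

End ClinCalculus.

(** * Symmetry of second derivatives *)

Section Schwarz.
Context {R : realType} {E : normedModType R}.

Lemma is_derive_line (f : E -> R^o) (b v : E) (r : R) :
  differentiable f (r *: v + b) ->
  is_derive (r : R^o) (1 : R^o) (fun r : R^o => f (r *: v + b)) ('d f (r *: v + b) v).
Proof.
move=> df.
have hl : is_diff (r : R^o) (fun r : R^o => r *: v + b) (fun r : R^o => r *: v).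
  have := is_diffD (is_diff_scalel r v) (is_diff_cst b (r : R^o)).
  by rewrite addr0.
have hc : is_diff (r : R^o) (f \o (fun r : R^o => r *: v + b))
    ('d f (r *: v + b) \o (fun r : R^o => r *: v)).
  exact: is_diff_comp hl (differentiableP df).
have [dc ec] := hc.
split; first exact: diff_derivable.
by rewrite (deriveE _ dc) ec /= scale1r.
Qed.

Variables (f : E -> R^o) (a : E).
Hypothesis f_diff : \forall x \near a, differentiable f x.
Let df x := to_clin ('d f x).
Hypothesis df_diff : differentiable df a.

(** The second difference of f is symmetric in u and v, while the mean value
theorem, applied to the increment of f along u as it moves along v, compares it
with s^2 times D^2 f (u, v). *)
Lemma second_difference (u v : E) (e : R) : 0 < e ->
  exists2 d : R, 0 < d & forall s, 0 < s -> s < d ->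
  `|f (s *: v + (s *: u + a)) - f (s *: u + a) - (f (s *: v + a) - f a)
    - s ^+ 2 * ('d df a u : clin E R^o) v| <= 2 * e * (`|u| + `|v| + 1) ^+ 2 * s ^+ 2.
Proof.
move=> e0; set k := _ + _ + 1.
have k0 : 0 < k by rewrite ltr_wpDl// addr_ge0.
have /nbhs_ballP[d0 /= d00 near0] : \forall h \near (0 : E),
    differentiable f (h + a) /\ `|df (h + a) - df a - 'd df a h| <= e * `|h|.
  near=> h; split; last by near: h; exact: diff_eps.
  near: h; rewrite [\forall h \near _, differentiable _ _](near_shift a) sub0r.
  by near=> h; rewrite /= subrK; near: h.
exists (d0 / k); first exact: divr_gt0.
move=> s s0 sd.
have sk : s * k < d0 by rewrite -ltr_pdivlMr.
have small r t : `|r| <= s -> `|t| <= s -> `|t *: v + r *: u| <= s * k.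
  move=> rs ts; rewrite (le_trans (ler_normD _ _))// !normrZ.
  rewrite (@le_trans _ _ (s * `|v| + s * `|u|))//.
    by rewrite lerD// ler_wpM2r.
  by rewrite -mulrDr ler_wpM2l ?(ltW s0)// addrC ler_wpDr.
have ball_small r t : `|r| <= s -> `|t| <= s ->
    differentiable f (t *: v + (r *: u + a)) /\
    `|df (t *: v + (r *: u + a)) - df a - 'd df a (t *: v + r *: u)| <= e * (s * k).
  move=> rs ts; have := small _ _ rs ts => hsk.
  rewrite addrA.
  have [|? hl] := near0 (t *: v + r *: u).
    by rewrite -ball_normE /ball_/= sub0r normrN (le_lt_trans hsk).
  by split=> //; rewrite (le_trans hl)// ler_wpM2l// ltW.
have s_s : `|s| <= s by rewrite gtr0_norm.
have z_s : `|0 : R| <= s by rewrite normr0 ltW.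
pose phi (r : R) : R := f (r *: v + (s *: u + a)) - f (r *: v + a).
pose dphi (r : R) : R := 'd f (r *: v + (s *: u + a)) v - 'd f (r *: v + a) v.
have phi_der (r : R) : `|r| <= s -> is_derive r 1 phi (dphi r).
  move=> rs; apply: is_deriveB; apply: is_derive_line.
    by have [] := ball_small _ _ s_s rs.
  by have [] := ball_small _ _ z_s rs; rewrite scale0r add0r.
have [] := @MVT_segment R phi dphi 0 s (ltW s0).
- move=> x; rewrite in_itv/= => /andP[x0 xs]; apply: phi_der.
  by rewrite gtr0_norm// ltW.
- apply: derivable_within_continuous => x; rewrite in_itv/= => /andP[x0 xs].
  by apply: (@ex_derive _ _ _ _ _ _ _ (phi_der x _)); rewrite ger0_norm.
move=> c; rewrite in_itv/= subr0 => /andP[c0 cs].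
rewrite {1 2}/phi !scale0r !add0r => phiE.
have c_s : `|c| <= s by rewrite ger0_norm.
have [d1 h1] := ball_small _ _ s_s c_s.
have [d2 h2] := ball_small _ _ z_s c_s.
rewrite !scale0r !addr0 !add0r in d2 h2.
have -> : f (s *: v + (s *: u + a)) - f (s *: u + a) - (f (s *: v + a) - f a) =
    dphi c * s by rewrite -phiE; ring.
(* The errors of the first-order expansion of df at a, at the two points where
   dphi c evaluates df. *)
pose w1 := df (c *: v + (s *: u + a)) - df a - 'd df a (c *: v + s *: u).
pose w2 := df (c *: v + a) - df a - 'd df a (c *: v).
have -> : dphi c * s - s ^+ 2 * ('d df a u : clin E R^o) v = (w1 v - w2 v) * s.
  rewrite /w1 /w2 linearD !linearZ !(clinDE, clinNE, clinZE) /dphi.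
  have d3 := nbhs_singleton f_diff.
  by rewrite /df !to_clin_diffE//= /GRing.scale/=; ring.
rewrite normrM (gtr0_norm s0) (_ : _ * s ^+ 2 = (2 * e * k ^+ 2 * s) * s); last by ring.
rewrite ler_wpM2r ?(ltW s0)// (le_trans (ler_normB _ _))//.
have wk (w : clin E R^o) : `|w| <= e * (s * k) -> `|w v| <= e * (s * k) * k.
  move=> hw; apply: (le_trans (clin_norm_le _ _)).
  by rewrite ler_pM ?opnorm_ge0// /k addrAC ler_wpDl// addr_ge0.
rewrite (@le_trans _ _ (e * (s * k) * k + e * (s * k) * k))//.
  by rewrite lerD// wk.
by rewrite le_eqVlt; apply/orP; left; apply/eqP; ring.
Unshelve. all: by end_near. Qed.

Lemma schwarz (u v : E) :
  ('d df a u : clin E R^o) v = ('d df a v : clin E R^o) u.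
Proof.
set x := LHS; set y := RHS; pose k := `|u| + `|v| + 1.
have k0 : 0 < k by rewrite ltr_wpDl// addr_ge0.
apply/eqP; rewrite -subr_eq0 -normr_le0; apply/ler_addgt0Pl => e e0; rewrite addr0.
pose e' := e / (4 * k ^+ 2).
have e'0 : 0 < e' by rewrite divr_gt0// mulr_gt0// exprn_gt0.
have [d1 d10 h1] := second_difference u v e'0.
have [d2 d20 h2] := second_difference v u e'0.
pose s := Num.min d1 d2 / 2.
have m0 : 0 < Num.min d1 d2 by rewrite lt_min d10.
have s0 : 0 < s by rewrite divr_gt0.
have sm : s < Num.min d1 d2 by rewrite ltr_pdivrMr// ltr_pMr// ltr1n.
have [sd1 sd2] : s < d1 /\ s < d2 by apply/andP; rewrite -lt_min.
have {}h1 := h1 s s0 sd1; have {}h2 := h2 s s0 sd2.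
rewrite -/x -/k in h1; rewrite -/y [`|v| + _]addrC -/k in h2.
rewrite [s *: u + (s *: v + a)]addrCA in h2.
have := le_trans (ler_normB _ _) (lerD h2 h1).
set A := _ - _ - s ^+ 2 * y; set B := _ - _ - s ^+ 2 * x.
have -> : A - B = (x - y) * s ^+ 2 by rewrite /A /B; ring.
rewrite normrM (ger0_norm (sqr_ge0 s)).
rewrite (_ : 2 * e' * k ^+ 2 * s ^+ 2 + _ = e * s ^+ 2) ?ler_pM2r ?exprn_gt0//.
by rewrite /e'; field; rewrite gt_eqF.
Qed.

End Schwarz.

(** * Charts and right translations *)

Section Charts.
Context {R : realType} {E : normedModType R} {M : topologicalType}.
Variables (C : atlas E M) (CM : smooth_manifold C).

Lemma near_chart_dom p q : chart_dom C p q -> \forall q' \near q, chart_dom C p q'.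
Proof. by move=> pq; apply: open_nbhs_nbhs; split=> //; exact: chart_dom_open. Qed.

Lemma near_chart_img p q : chart_dom C p q ->
  \forall x \near chart C p q, (chart C p @` chart_dom C p) x.
Proof.
by move=> pq; apply: open_nbhs_nbhs; split; [exact: chart_img_open|exists q].
Qed.

Lemma chart_invK p x : (chart C p @` chart_dom C p) x ->
  chart_dom C p (chart_inv C p x) /\ chart C p (chart_inv C p x) = x.
Proof. by move=> [q pq <-]; rewrite chartK. Qed.

Lemma chart_inv_cvg p q : chart_dom C p q ->
  chart_inv C p x @[x --> chart C p q] --> q.
Proof.
move=> pq; rewrite -[X in _ --> X](chartK CM pq).
by apply: (chart_inv_continuous CM); exists q.
Qed.

Lemma near_chart_inv p q (P : M -> Prop) : chart_dom C p q ->
  (\forall q' \near q, P q') -> \forall x \near chart C p q, P (chart_inv C p x).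
Proof. by move=> pq Pq; exact: chart_inv_cvg. Qed.

End Charts.

Section RightTranslations.
Context {R : realType} {E : normedModType R} (G : lieGroupType E).
Local Notation A := (lie_atlas : atlas E G).
Local Notation phi := (chart A).
Local Notation dom := (chart_dom A).
Local Notation e0 := (phi 1%g 1%g).

Let AM : smooth_manifold A := @lie_manifold R E G.

Definition inl_clin : clin E (E * E)%type := to_clin (fun v : E => (v, 0 : E)).

Lemma inl_clinE (v : E) : inl_clin v = (v, 0).
Proof.
rewrite /inl_clin to_clinE//.
  by move=> a x y; rewrite -[RHS]/(_, a *: 0 + 0) scaler0 addr0.
by move=> x; apply: cvg_pair; [exact: cvg_id|exact: cvg_cst].
Qed.

Lemma rmul_continuous (k : G) : continuous (rmul k).
Proof.
move=> h; have [mc _] := @mulg_smooth R E G.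
apply: (@continuous_comp _ _ _ (fun h => (h, k)) (fun p => (p.1 * p.2)%g)).
  by apply: cvg_pair; [exact: cvg_id|exact: cvg_cst].
exact: mc.
Qed.

(** The multiplication read in the charts around p, q and p * q. Everything needed
about smoothness of right translations and of the frame is obtained by freezing
one of its two variables. *)
Definition mul_rep (p q : G) (z : E * E) : E :=
  phi (p * q)%g (chart_inv A p z.1 * chart_inv A q z.2)%g.

Lemma mul_rep_diff (p q : G) :
  (\forall z \near (phi p p, phi q q), differentiable (mul_rep p q) z) /\
  differentiable (fun z => to_clin ('d (mul_rep p q) z)) (phi p p, phi q q).
Proof.
have [mc /(_ (p, q)) ms] := @mulg_smooth R E G.
have [/= d1 [d2 _]] := ms 2%N.
have pp := chart_dom_refl AM p; have qq := chart_dom_refl AM q.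
have pqpq := chart_dom_refl AM (p * q)%g.
split; last by apply: d2; exists (p, q).
suff : \forall z \near (phi p p, phi q q),
  (chart (prod_atlas A A) (p, q) @` (chart_dom (prod_atlas A A) (p, q) `&`
    (fun p => (p.1 * p.2)%g) @^-1` chart_dom A (p * q)%g)) z.
  by apply: filterS => z; exact: d1.
have near_mul : \forall z \near (p, q), dom (p * q)%g (z.1 * z.2)%g.
  by apply: mc; exact: near_chart_dom.
have inv_cts : (chart_inv A p z.1, chart_inv A q z.2) @[z --> (phi p p, phi q q)]
    --> (p, q).
  apply: cvg_pair.
    by apply: (cvg_comp (@fst E E) (chart_inv A p)); [exact: cvg_fst|exact: chart_inv_cvg].
  by apply: (cvg_comp (@snd E E) (chart_inv A q)); [exact: cvg_snd|exact: chart_inv_cvg].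
have near_mulz := inv_cts _ near_mul.
near=> z.
have [z1d z1E] : dom p (chart_inv A p z.1) /\ phi p (chart_inv A p z.1) = z.1.
  apply: chart_invK; first exact: AM.
  by near: z; apply: cvg_fst; exact: near_chart_img.
have [z2d z2E] : dom q (chart_inv A q z.2) /\ phi q (chart_inv A q z.2) = z.2.
  apply: chart_invK; first exact: AM.
  by near: z; apply: cvg_snd; exact: near_chart_img.
exists (chart_inv A p z.1, chart_inv A q z.2); last first.
  by rewrite /= z1E z2E -surjective_pairing.
by split=> //=; near: z; exact: near_mulz.
Unshelve. all: by end_near. Qed.

(** Right translation by k, read in the charts around p and r. With k = 1 these
are the changes of charts, so that [diff_rep_comp] contains both the chain rule
for translations and the change of charts for tangent vectors. *)
Definition rep (r k p : G) : E -> E := phi r \o rmul k \o chart_inv A p.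

Lemma rep1 r p : rep r 1%g p = phi r \o chart_inv A p.
Proof. by apply/funext => x; rewrite /rep/= /rmul mulg1. Qed.

(** Partial differentiation in the first factor, the second being the point with
coordinates x. *)
Lemma mul_rep_fst (p q : G) (x y : E) : differentiable (mul_rep p q) (y, x) ->
  is_diff y (rep (p * q)%g (chart_inv A q x) p)
    (clin_comp (to_clin ('d (mul_rep p q) (y, x))) inl_clin).
Proof.
move=> dm.
have dpair : is_diff y (fun y => (y, x)) (fun v : E => (v, 0 : E)).
  exact: is_diff_pair (is_diff_id y) (is_diff_cst x y).
have := is_diff_comp dpair (differentiableP dm).
rewrite (_ : 'd _ _ \o _ = clin_comp (to_clin ('d (mul_rep p q) (y, x))) inl_clin)//.
by apply/funext => v; rewrite clin_compE inl_clinE to_clin_diffE.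
Qed.

Lemma rep_diff_center (h k : G) : differentiable (rep (h * k)%g k h) (phi h h).
Proof.
have [/nbhs_singleton/mul_rep_fst [+ _] _] := mul_rep_diff h k.
by rewrite chartK//; exact: chart_dom_refl.
Qed.

Lemma rep_comp_near (s l r k p h : G) : dom p h -> dom r (h * k)%g ->
  \forall x \near phi p h, rep s l r (rep r k p x) = rep s (k * l)%g p x.
Proof.
move=> ph rhk.
have : \forall h' \near h, dom r (rmul k h').
  by apply: rmul_continuous; exact: near_chart_dom.
move=> /(near_chart_inv AM ph); apply: filterS => x xr.
by rewrite /rep/= chartK// /rmul mulgA.
Qed.

Lemma rep_transition_diff (r p h : G) : dom p h -> dom r h ->
  differentiable (rep r 1%g p) (phi p h).
Proof.
move=> ph rh; rewrite rep1.
have [d1 _] := chart_compatible AM p r 1%N.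
by apply: d1; exists h.
Qed.

Lemma rep_center (r k p h : G) : dom p h -> rep r k p (phi p h) = phi r (h * k)%g.
Proof. by move=> ph; rewrite /rep/= chartK. Qed.

(** [rep_diff_center] only covers the charts around h and h * k; the general case
composes it with two changes of charts. *)
Lemma rep_diff (r k p h : G) : dom p h -> dom r (h * k)%g ->
  differentiable (rep r k p) (phi p h).
Proof.
move=> ph rhk; have hh := chart_dom_refl AM h.
have hkhk := chart_dom_refl AM (h * k)%g.
have d1 : differentiable (rep (h * k)%g k p) (phi p h).
  have dt := rep_transition_diff ph hh.
  have := @is_diff_comp _ _ _ _ _ _ (rep (h * k)%g k h) _ _ (differentiableP dt).
  rewrite rep_center// mulg1 => /(_ _ (differentiableP (rep_diff_center h k))) d.
  refine (@ex_diff _ _ _ _ _ _ _ (is_diff_near_eq _ d)).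
  have := @rep_comp_near (h * k)%g k h 1%g p h ph.
  by rewrite mulg1 mul1g; apply.
have dt := rep_transition_diff hkhk rhk.
have := @is_diff_comp _ _ _ _ _ _ (rep r 1%g (h * k)%g) _ _ (differentiableP d1).
rewrite rep_center// => /(_ _ (differentiableP dt)) d.
refine (@ex_diff _ _ _ _ _ _ _ (is_diff_near_eq _ d)).
by have := rep_comp_near r 1%g ph hkhk; rewrite mulg1.
Qed.

Lemma diff_rep_comp (s l r k p h : G) :
  dom p h -> dom r (h * k)%g -> dom s (h * k * l)%g ->
  'd (rep s (k * l)%g p) (phi p h) =
  'd (rep s l r) (phi r (h * k)%g) \o 'd (rep r k p) (phi p h) :> (E -> E).
Proof.
move=> ph rhk shkl.
have := @is_diff_comp _ _ _ _ _ _ (rep s l r) _ _ (differentiableP (rep_diff ph rhk)).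
rewrite rep_center// => /(_ _ (differentiableP (rep_diff rhk shkl))) d.
by have [] := is_diff_near_eq (rep_comp_near s l ph rhk) d.
Qed.

Lemma diff_rep_id (p h : G) : dom p h -> 'd (rep p 1%g p) (phi p h) = id :> (E -> E).
Proof.
move=> ph.
have [] // := @is_diff_near_eq _ _ _ id (rep p 1%g p) id _ _ (is_diff_id (phi p h)).
apply: filterS (near_chart_img AM ph) => x /(chart_invK AM)[_ xE].
by rewrite rep1/= xE.
Qed.

Lemma TeRE (g : G) : TeR g = 'd (rep g g 1%g) e0 :> (E -> E).
Proof. by rewrite /TeR /tangent_map /rmul mul1g. Qed.

Lemma TeR_1 (xi : lie_algebra G) : TeR (1%g : G) xi = xi.
Proof. by rewrite TeRE diff_rep_id//; exact: chart_dom_refl. Qed.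

Lemma TeR_continuous (g : G) : continuous (TeR g : E -> E).
Proof.
rewrite TeRE; apply: diff_continuous; apply: rep_diff; first exact: chart_dom_refl.
by rewrite mul1g; exact: chart_dom_refl.
Qed.

Lemma TeR_linear (g : G) : linear (TeR g : E -> E).
Proof. by rewrite TeRE; exact: linearP. Qed.

(** The inverse is the tangent at g of right translation by g^-1. *)
Lemma TeR_bijective (g : G) : exists2 Bi : clin E E,
  (forall v, Bi (TeR g v) = v) & (forall v, TeR g (Bi v) = v).
Proof.
have gg := chart_dom_refl AM g; have d11 := chart_dom_refl AM 1%g.
have ginv : dom 1%g (g * g^-1)%g by rewrite mulgV.
exists (to_clin ('d (rep 1%g g^-1%g g) (phi g g))) => v.
  rewrite to_clin_diffE ?TeRE; last exact: rep_diff.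
  have := @diff_rep_comp 1%g g^-1%g g g 1%g 1%g d11.
  rewrite mul1g => /(_ gg ginv); rewrite mulgV diff_rep_id//.
  by move=> /(congr1 (@^~ v))/=.
rewrite to_clin_diffE ?TeRE; last exact: rep_diff.
have := @diff_rep_comp g g 1%g g^-1%g g g gg ginv.
by rewrite mulgV mul1g mulVg diff_rep_id// => /(_ gg) /(congr1 (@^~ v))/=.
Qed.

End RightTranslations.

(** * The right invariant frame *)

(** The value at the point with coordinates x of the right invariant vector
field generated by xi is [frame p x xi], in the chart around p. Locked for the
same reason as [clin_comp]. *)
HB.lock Definition frame {R : realType} {E : normedModType R} {G : lieGroupType E}
    (p : G) (x : E) : clin E E :=
  to_clin ('d (rep p (chart_inv (@lie_atlas R E G) p x) 1%g)
              (chart (@lie_atlas R E G) 1%g 1%g)).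

Section Frame.
Context {R : realType} {E : normedModType R} (G : lieGroupType E).
Local Notation A := (lie_atlas : atlas E G).
Local Notation phi := (chart A).
Local Notation dom := (chart_dom A).
Local Notation e0 := (phi 1%g 1%g).

Let AM : smooth_manifold A := @lie_manifold R E G.

Let dom1 : dom 1%g 1%g := chart_dom_refl AM 1%g.

Lemma frameE (p q : G) (v : E) : dom p q ->
  frame p (phi p q) v = 'd (rep p q 1%g) e0 v.
Proof.
move=> pq; rewrite unlock chartK// to_clin_diffE//.
by apply: rep_diff => //; rewrite mul1g.
Qed.

Lemma frame_center (p : G) : frame p (phi p p) = TeR p :> (E -> E).
Proof.
by apply/funext => v; rewrite frameE ?TeRE//; exact: chart_dom_refl.
Qed.

Lemma near_slice_fst (P : E * E -> Prop) (a b : E) :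
  (\forall z \near (a, b), P z) -> \forall y \near a, P (y, b).
Proof. by apply: (cvg_pair (@cvg_id _ _) (cvg_cst _)). Qed.

Lemma near_slice_snd (P : E * E -> Prop) (a b : E) :
  (\forall z \near (a, b), P z) -> \forall x \near b, P (a, x).
Proof. by apply: (cvg_pair (cvg_cst _) (@cvg_id _ _)). Qed.

(** Near the coordinates of p, the frame is the partial derivative in the first
variable of the multiplication around (e, p), taken at e. *)
Lemma frame_diff (p : G) : differentiable (frame p) (phi p p).
Proof.
have [d1 d2] := mul_rep_diff 1%g p.
pose D x := clin_comp (to_clin ('d (mul_rep 1%g p) (e0, x))) (@inl_clin R E).
have near_eq : \forall x \near phi p p, D x = frame p x.
  apply: filterS (near_slice_snd d1) => x /mul_rep_fst[_].
  rewrite mul1g => dE; apply: clinP => v.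
  by rewrite unlock dE to_clinE//; [exact: clin_linear|exact: clin_continuous].
have dpair : is_diff (phi p p) (fun x => (e0, x)) (fun v : E => (0 : E, v)).
  exact: is_diff_pair (is_diff_cst _ _) (is_diff_id _).
have dD := is_diff_clin_comp (is_diff_comp dpair (differentiableP d2))
  (is_diff_cst (@inl_clin R E) (phi p p)).
exact: (@ex_diff _ _ _ _ _ _ _ (is_diff_near_eq near_eq dD)).
Qed.

(** Here the second factor of the multiplication is frozen at k. *)
Lemma rep_diff2 (p k : G) :
  (\forall y \near phi p p, differentiable (rep (p * k)%g k p) y) /\
  differentiable (fun y => to_clin ('d (rep (p * k)%g k p) y)) (phi p p).
Proof.
have [d1 d2] := mul_rep_diff p k.
have kk := chart_dom_refl AM k.
pose D y := clin_comp (to_clin ('d (mul_rep p k) (y, phi k k))) (@inl_clin R E).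
have slice y : differentiable (mul_rep p k) (y, phi k k) ->
    is_diff y (rep (p * k)%g k p) (D y).
  by move=> /mul_rep_fst; rewrite chartK.
split; first by apply: filterS (near_slice_fst d1) => y /slice[].
have near_eq : \forall y \near phi p p, D y = to_clin ('d (rep (p * k)%g k p) y).
  apply: filterS (near_slice_fst d1) => y /slice[_ dE]; apply: clinP => v.
  by rewrite dE to_clinE//; [exact: clin_linear|exact: clin_continuous].
have dpair : is_diff (phi p p) (fun y => (y, phi k k)) (fun v : E => (v, 0 : E)).
  exact: is_diff_pair (is_diff_id _) (is_diff_cst _ _).
have dD := is_diff_clin_comp (is_diff_comp dpair (differentiableP d2))
  (is_diff_cst (@inl_clin R E) (phi p p)).
exact: (@ex_diff _ _ _ _ _ _ _ (is_diff_near_eq near_eq dD)).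
Qed.

Definition dframe (p : G) (u : E) : clin E E := 'd (frame p) (phi p p) u.

Lemma dframe_linear (p : G) : linear (dframe p).
Proof. by move=> a u v; rewrite /dframe linearP. Qed.

Lemma diff_frame_at (p : G) (xi : E) :
  is_diff (phi p p) (fun x => frame p x xi) (fun u => dframe p u xi).
Proof.
pose evM := GRing.isLinear.Build _ _ _ _ _ (@clin_eval_linear R E E xi).
pose ev : {linear clin E E -> E} := HB.pack (fun f : clin E E => f xi) evM.
have ev_cont : continuous ev by exact: clin_eval_continuous.
have dev : is_diff (frame p (phi p p)) ev ev.
  by split; [exact: linear_differentiable|exact: diff_lin].
exact: is_diff_comp (differentiableP (frame_diff p)) dev.
Qed.

Lemma local_rep_right_inv (p q : G) (xi : lie_algebra G) : dom p q ->
  local_rep (right_inv_field xi) p (phi p q) = frame p (phi p q) xi.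
Proof.
move=> pq; have qq := chart_dom_refl AM q.
rewrite frameE// /local_rep chartK// /right_inv_field TeRE /tangent_map.
have := @diff_rep_comp R E G p 1%g q q 1%g 1%g dom1.
rewrite mul1g mulg1 => /(_ qq pq) ->.
by rewrite rep1.
Qed.

(** The frame at e is the identity, so the fields generated by xi and eta take the
values xi and eta there, and their derivatives are read off from the frame. *)
Lemma lie_bracketE (xi eta : lie_algebra G) :
  lie_bracket xi eta = dframe (1%g : G) xi eta - dframe (1%g : G) eta xi.
Proof.
have dl (zeta : lie_algebra G) :
    'd (local_rep (right_inv_field zeta) (1%g : G)) e0 =
    (fun u => dframe (1%g : G) u zeta) :> (E -> E).
  have [] // := @is_diff_near_eq _ _ _ (fun x => frame (1%g : G) x zeta)
    (local_rep (right_inv_field zeta) 1%g) _ _ _ (diff_frame_at 1%g zeta).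
  apply: filterS (near_chart_img AM dom1) => _ [q q1 <-].
  by rewrite local_rep_right_inv.
by rewrite /lie_bracket /jacobi_lie !dl /right_inv_field !TeR_1.
Qed.

(** The right invariance of the fields, x |-> frame x xi, in coordinates: this is
the chain rule for right translation by h followed by right translation by g. *)
Lemma frame_rmul (g h : G) : dom 1%g h -> dom g (h * g)%g ->
  frame g (rep g g 1%g (phi 1%g h)) =
  clin_comp (to_clin ('d (rep g g 1%g) (phi 1%g h))) (frame (1%g : G) (phi 1%g h)).
Proof.
move=> h1 hg; apply: clinP => v; rewrite clin_compE rep_center// !frameE//.
rewrite to_clin_diffE; last exact: rep_diff.
have := @diff_rep_comp R E G g g 1%g h 1%g 1%g dom1.
by rewrite mul1g => /(_ h1 hg) ->.
Qed.

(** [schwarz] for the composite of alpha with right translation by g, whose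
derivative is [clin_comp alpha] applied to that of the translation. *)
Lemma diff2_rep_sym (g : G) (alpha : clin E R^o) (u v : E) :
  let D2 := 'd (fun y => to_clin ('d (rep g g 1%g) y)) e0 in
  alpha ((D2 u : clin E E) v) = alpha ((D2 v : clin E E) u).
Proof.
have [d1 d2] := rep_diff2 1%g g; rewrite mul1g in d1 d2.
pose f := alpha \o rep g g 1%g.
have dalpha x : is_diff x alpha alpha.
  have ca : continuous alpha by exact: clin_continuous.
  by split; [exact: linear_differentiable|exact: diff_lin].
have df y : differentiable (rep g g 1%g) y ->
    is_diff y f (alpha \o 'd (rep g g 1%g) y).
  by move=> dy; exact: is_diff_comp (differentiableP dy) (dalpha _).
have near_eq : \forall y \near e0,
    clin_comp alpha (to_clin ('d (rep g g 1%g) y)) = to_clin ('d f y).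
  apply: filterS d1 => y dy; have [dfy dfE] := df y dy.
  by apply: clinP => w; rewrite clin_compE !to_clin_diffE// dfE.
have dD := is_diff_clin_comp (is_diff_cst alpha e0) (differentiableP d2).
have [d2f d2fE] := is_diff_near_eq near_eq dD.
have f_diff : \forall y \near e0, differentiable f y.
  by apply: filterS d1 => y /df[].
have := @schwarz R E f e0 f_diff d2f u v; rewrite d2fE /=.
by rewrite linear0l !addr0 !clin_compE.
Qed.

(** Right invariance of the Jacobi-Lie bracket, tested on alpha: the left side is
the bracket at g of the fields generated by xi and eta. *)
Lemma dframe_bracket (g : G) (alpha : clin E R^o) (xi eta : lie_algebra G) :
  alpha (dframe g (TeR g xi) eta) - alpha (dframe g (TeR g eta) xi) =
  alpha (TeR g (lie_bracket xi eta)).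
Proof.
have gg := chart_dom_refl AM g.
pose D2 := 'd (fun y => to_clin ('d (rep g g 1%g) y)) e0.
have [d1 d2] := rep_diff2 1%g g; rewrite mul1g in d1 d2.
have near_eq : \forall y \near e0,
    clin_comp (to_clin ('d (rep g g 1%g) y)) (frame (1%g : G) y) =
    frame g (rep g g 1%g y).
  have hg : \forall h \near (1%g : G), dom g (rmul g h).
    by apply: rmul_continuous; rewrite /rmul mul1g; exact: near_chart_dom.
  have := near_chart_inv AM dom1 hg; apply: filterS2 (near_chart_img AM dom1).
  by move=> _ [h h1 <-]; rewrite chartK// => hgg; rewrite frame_rmul.
have dl := is_diff_clin_comp (differentiableP d2) (differentiableP (frame_diff 1%g)).
have dr : is_diff e0 (frame g \o rep g g 1%g) (dframe g \o TeR g).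
  have dg : is_diff e0 (rep g g 1%g) (TeR g).
    by rewrite TeRE; apply/differentiableP/rep_diff => //; rewrite mul1g.
  have := @is_diff_comp _ _ _ _ _ _ (frame g) (dframe g) e0 dg; apply.
  by rewrite rep_center// mul1g; exact/differentiableP/frame_diff.
(* The derivative of frame_rmul at e in the direction u, applied to v. *)
have key u v : dframe g (TeR g u) v = TeR g (dframe (1%g : G) u v) + (D2 u : clin E E) v.
  have [_ dlE] := is_diff_near_eq near_eq dl.
  have [_ drE] := dr; have := etrans (esym drE) dlE.
  move=> /(congr1 (fun F => (F u : clin E E) v)) /= ->.
  rewrite -[LHS]/(clin_comp _ _ v + clin_comp _ _ v) !clin_compE frame_center.
  rewrite TeR_1 to_clin_diffE ?TeRE//.
  exact: nbhs_singleton d1.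
rewrite !key lie_bracketE !linearD /=.
rewrite (diff2_rep_sym g alpha xi eta).
have -> w1 w2 : TeR g (w1 - w2) = TeR g w1 - TeR g w2 :> E.
  by rewrite TeRE linearB.
by rewrite linearB /=; ring.
Qed.

End Frame.

(** * The right trivialization of the cotangent bundle *)

Section ToDual.
Context {R : realType} {E : normedModType R}.

Lemma to_dual_comp (F : normedModType R) (a : dual F) (L : E -> F) :
  linear L -> continuous L ->
  to_dual (fun v => pairing a (L v)) = clin_comp (a : clin F R^o) (to_clin L).
Proof.
move=> lL cL; rewrite /to_dual unlock; congr to_clin.
by apply/funext => v /=; rewrite to_clinE.
Qed.

Lemma clin_comp_id (F : normedModType R) (a : clin E F) : clin_comp a (to_clin id) = a.
Proof.
apply: clinP => v; rewrite clin_compE to_clinE//.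
by move=> x; exact: cvg_id.
Qed.

Lemma to_dualE (f : E -> R^o) v :
  linear f -> continuous f -> pairing (to_dual f) v = f v.
Proof. exact: to_clinE. Qed.

End ToDual.

Section Trivialization.
Context {R : realType} {E : normedModType R} (G : lieGroupType E).
Local Notation A := (lie_atlas : atlas E G).
Local Notation phi := (chart A).
Local Notation dom := (chart_dom A).

Let AM : smooth_manifold A := @lie_manifold R E G.

Lemma to_clin_TeR (g : G) : @to_clin R E E (TeR g) = frame g (phi g g).
Proof.
apply: (@clinP R E E) => v.
rewrite (@to_clinE R E E (TeR g) v (TeR_linear g) (@TeR_continuous R E G g)).
by rewrite (frame_center g).
Qed.

Lemma frame_transition (g q : G) : dom g q ->
  clin_comp (to_clin ('d (rep g 1%g q) (phi q q))) (frame q (phi q q)) =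
  frame g (phi g q).
Proof.
move=> gq; have qq := chart_dom_refl AM q; apply: clinP => v.
have dr : differentiable (rep g 1%g q) (phi q q) by apply: rep_diff => //; rewrite mulg1.
rewrite clin_compE !frameE// to_clin_diffE//.
have := @diff_rep_comp R E G g 1%g q q 1%g 1%g (chart_dom_refl AM 1%g).
by rewrite mul1g mulg1 => /(_ qq gq) ->.
Qed.

Lemma TeR_dualE (g : G) (alpha : clin E R^o) :
  TeR_dual (g := g) alpha = clin_comp alpha (frame g (phi g g)).
Proof.
rewrite -to_clin_TeR; apply: (@to_dual_comp R E E alpha (TeR g)).
- exact: TeR_linear.
- exact: TeR_continuous.
Qed.

Lemma pairing_TeR_dual (g : G) (alpha : dual E) (eta : E) :
  pairing (TeR_dual (g := g) alpha) eta = pairing alpha (TeR g eta).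
Proof. by rewrite TeR_dualE /pairing clin_compE frame_center. Qed.

Lemma chart_cotangent (g : G) (alpha : dual E) :
  chart (cotangent_atlas A) (g, alpha) (g, alpha) = (phi g g, alpha).
Proof.
have gg := chart_dom_refl AM g.
have := diff_rep_id gg; rewrite rep1 => dE.
rewrite /= dE; congr pair.
rewrite (_ : (fun v => _) = (fun v => pairing alpha (id v)))//.
by rewrite to_dual_comp ?clin_comp_id// => x; exact: cvg_id.
Qed.

(** In the fibre over the point q with coordinates x, changing from the chart
around g to the one around q and then trivializing at q composes p with the
frame of the chart around g. *)
Lemma right_triv_rep (g : G) (alpha : dual E) (x : E) (p : clin E R^o) :
  (phi g @` dom g) x ->
  (chart (triv_atlas G) (g, alpha) \o right_triv G
     \o chart_inv (cotangent_atlas A) (g, alpha)) (x, p) =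
  (x, clin_comp p (frame g x)).
Proof.
move=> [q gq <-]; have qq := chart_dom_refl AM q.
rewrite /= chartK//; congr pair.
have dr : differentiable (rep g 1%g q) (phi q q) by apply: rep_diff => //; rewrite mulg1.
rewrite -(rep1 g q) (to_dual_comp p (L := 'd (rep g 1%g q) (phi q q))); last 2 first.
- exact: linearP.
- exact: diff_continuous.
rewrite TeR_dualE -(frame_transition gq).
apply: (@clinP R E R^o) => v.
by rewrite !(@clin_compE R E).
Qed.

Lemma tangent_right_triv (g : G) (alpha : clin E R^o) (v : E) (nu : clin E R^o) :
  tangent_map (cotangent_atlas A) (triv_atlas G) (right_triv G)
    ((g, alpha) : cotangent_bundle A) (v, nu) =
  (v, clin_comp alpha (dframe g v) + clin_comp nu (frame g (phi g g))).
Proof.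
rewrite /tangent_map chart_cotangent.
pose F (z : E * clin E R^o) := (z.1, clin_comp z.2 (frame g z.1)).
have d1 : is_diff (phi g g, alpha) (@fst E (@clin R E R^o)) fst.
  pose f : {linear (E * clin E R^o)%type -> E} := fst.
  by split; [apply: (linear_differentiable (f := f))|apply: (diff_lin (f := f))];
    move=> z; exact: cvg_fst.
have d2 : is_diff (phi g g, alpha) (@snd E (@clin R E R^o)) snd.
  pose f : {linear (E * clin E R^o)%type -> clin E R^o} := snd.
  by split; [apply: (linear_differentiable (f := f))|apply: (diff_lin (f := f))];
    move=> z; exact: cvg_snd.
have dframe_g : is_diff (phi g g, alpha) (frame g \o fst) (dframe g \o fst).
  by apply: (is_diff_comp d1); apply: differentiableP; exact: frame_diff.
have dF := is_diff_pair d1 (is_diff_clin_comp d2 dframe_g).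
have near_eq : \forall z \near (phi g g, alpha), F z =
   (chart (triv_atlas G) (g, alpha) \o right_triv G
     \o chart_inv (cotangent_atlas A) (g, alpha)) z.
  have gg := chart_dom_refl AM g.
  have : \forall z \near (phi g g, alpha), (phi g @` dom g) z.1.
    by apply: cvg_fst; exact: near_chart_img.
  by apply: filterS => -[x p] xg; rewrite right_triv_rep.
have [_ ] := is_diff_near_eq near_eq dF.
by move=> ->.
Qed.

End Trivialization.

(** * The symplectic form and Hamiltonian vector fields *)

Section Pairing.
Context {R : realType} {E : normedModType R}.

Lemma pairing0r (mu : dual E) : pairing mu 0 = 0.
Proof. by rewrite /pairing linear0. Qed.

Lemma pairing0l (xi : E) : pairing 0 xi = 0.
Proof. by []. Qed.

End Pairing.

Section Reflexive.
Context {R : realType} {E : normedModType R}.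

Lemma eval_bidualE (xi : E) (tau : dual E) :
  pairing (eval_bidual xi) tau = pairing tau xi.
Proof.
apply: (@to_dualE R (dual E) (fun mu : dual E => pairing mu xi)).
  exact: (@clin_eval_linear R E R^o xi).
exact: (@clin_eval_continuous R E R^o xi).
Qed.

(** This turns an equation tested on all covectors into an equation in E; it is
where reflexivity enters. *)
Lemma of_bidual_eq (Phi : dual (dual E)) (xi : E) : reflexive_space E ->
  (forall tau : dual E, pairing Phi tau = pairing tau xi) -> of_bidual Phi = xi.
Proof.
move=> Erefl Phixi.
have PhiE : eval_bidual xi = Phi.
  by apply: (@clinP R (dual E) R^o) => tau; rewrite [RHS]Phixi; exact: eval_bidualE.
apply: (bij_inj Erefl); rewrite PhiE.
by apply: (@getPex _ [set xi | eval_bidual xi = Phi]); exists xi.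
Qed.

End Reflexive.

Section SymplecticForm.
Context {R : realType} {E : normedModType R} (G : lieGroupType E).
Local Notation A := (lie_atlas : atlas E G).
Local Notation phi := (chart A).
Local Notation g_ := (lie_algebra G).

Lemma lie_bracket_linear (xi : g_) : linear (lie_bracket xi : E -> E).
Proof.
move=> a u v; rewrite !lie_bracketE linearP dframe_linear.
rewrite -[X in _ - X]/(a *: dframe (1%g : G) u xi + dframe (1%g : G) v xi).
by rewrite scalerBr opprD addrACA.
Qed.

Lemma lie_bracket_continuous (xi : g_) : continuous (lie_bracket xi : E -> E).
Proof.
rewrite (_ : lie_bracket xi = (fun u => dframe (1%g : G) xi u - dframe (1%g : G) u xi)).
  move=> u; apply: cvgB; first exact: clin_continuous.
  have [d dE] := diff_frame_at (1%g : G) xi.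
  by have := diff_continuous d; rewrite dE; apply.
by apply/funext => u; exact: lie_bracketE.
Qed.

Lemma lie_bracket_clin (xi : g_) :
  exists L : clin E E, forall eta, L eta = lie_bracket xi eta.
Proof.
exists (to_clin (lie_bracket xi : E -> E)) => eta.
by rewrite (@to_clinE R E E (lie_bracket xi))//;
  [exact: lie_bracket_linear|exact: lie_bracket_continuous].
Qed.

Lemma ad_starE (xi eta : g_) (mu : dual g_) :
  pairing (ad_star xi mu) eta = pairing mu (lie_bracket xi eta).
Proof.
apply: (@to_dualE R E (fun eta => pairing mu (lie_bracket xi eta))).
  by move=> a u v; rewrite lie_bracket_linear /pairing linearP.
move=> u; apply: (@continuous_comp _ _ _ (lie_bracket xi) (mu : clin E R^o)).
  exact: lie_bracket_continuous.
exact: clin_continuous.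
Qed.

(** A tangent vector (T_e R_g zeta, rho) at (g, mu) is the image, under the
tangent of the trivialization at alpha = mu o (T_e R_g)^-1, of
(T_e R_g zeta, lift zeta rho), and on such preimages Omega is the canonical
form. With sigma = nu + ad*_xi mu and tau = lambda + ad*_eta mu this is the
usual formula nu eta - lambda xi + mu [xi, eta]. *)
Lemma symplectic_formE (Omega : two_form (triv_atlas G))
    (Omega_pushforward :
      is_pushforward (right_triv G) (canonical_form (@lie_atlas R E G)) Omega)
    (g : G) (mu sigma tau : dual g_) (xi eta : g_) :
  Omega (g, mu) (TeR g xi, sigma) (TeR g eta, tau) =
  pairing sigma eta - pairing tau xi - pairing mu (lie_bracket xi eta).
Proof.
have [Bi BiK BK] := TeR_bijective g.
pose B := frame g (phi g g).
have BE (v : E) : B v = TeR g v by rewrite /B frame_center.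
have [alpha alphaB] : exists alpha : clin E R^o, forall v, alpha (TeR g v) = pairing mu v.
  by exists (clin_comp (mu : clin E R^o) Bi) => v; rewrite clin_compE BiK.
pose lift (zeta : g_) (rho : dual g_) : clin E R^o :=
  clin_comp ((rho : clin E R^o) - clin_comp alpha (dframe g (TeR g zeta))) Bi.
have liftE zeta rho : clin_comp alpha (dframe g (TeR g zeta)) +
    clin_comp (lift zeta rho) B = rho.
  apply: (@clinP R E R^o) => v.
  rewrite -[LHS]/(clin_comp _ _ v + clin_comp _ _ v) !clin_compE BE BiK.
  rewrite -[X in _ + X]/(rho v - clin_comp _ _ v) clin_compE.
  by rewrite addrC subrK.
have alphaE : TeR_dual (g := g) alpha = mu.
  rewrite TeR_dualE; apply: (@clinP R E R^o) => v.
  by rewrite clin_compE -/B BE alphaB.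
have := Omega_pushforward (g, alpha) (TeR g xi, lift xi sigma) (TeR g eta, lift eta tau).
rewrite !tangent_right_triv -/B !liftE /right_triv/= alphaE => ->.
rewrite /canonical_form/= /pairing /lift !clin_compE !BiK.
rewrite -[X in X - _]/(sigma eta - clin_comp _ _ eta).
rewrite -[X in _ - X]/(tau xi - clin_comp _ _ xi) !clin_compE.
have := dframe_bracket g alpha xi eta; rewrite alphaB /pairing => <-.
by ring.
Qed.

End SymplecticForm.

Section Hamiltonian.
Context {R : realType} {E : normedModType R} (G : lieGroupType E).
Local Notation A := (lie_atlas : atlas E G).
Local Notation phi := (chart A).
Local Notation g_ := (lie_algebra G).

Let AM : smooth_manifold A := @lie_manifold R E G.

(** The derivative of H in the product chart is the sum of its two partial
derivatives; in the second one the first coordinate is frozen at g itself. *)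
Lemma differential_triv (H : G * dual g_ -> R)
    (H_smooth : smooth_map (triv_atlas G) (model_atlas R^o) H)
    (g : G) (mu tau : dual g_) (w : tangent A g) :
  pairing (differential (triv_atlas G) H (g, mu)) (w, tau) =
  pairing (partial_g H g mu) w +
  pairing (differential (model_atlas (dual g_)) (fun nu => H (g, nu)) mu) tau.
Proof.
pose Hloc (z : E * clin E R^o) : R^o := H (chart_inv A g z.1, z.2).
have gg := chart_dom_refl AM g.
have dH : differentiable Hloc (phi g g, mu : clin E R^o).
  by have [_ /(_ (g, mu) 1%N)[d _]] := H_smooth; apply: d; exists (g, mu).
have d1 : is_diff (phi g g) (fun x => Hloc (x, mu)) (fun v => 'd Hloc (phi g g, mu) (v, 0)).
  have dp := is_diff_pair (is_diff_id (phi g g)) (is_diff_cst (mu : clin E R^o) (phi g g)).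
  exact: is_diff_comp dp (differentiableP dH).
have d2 : is_diff (mu : clin E R^o) (fun nu : clin E R^o => H (g, nu) : R^o)
    (fun t => 'd Hloc (phi g g, mu) (0, t)).
  have dp := is_diff_pair (is_diff_cst (phi g g) (mu : clin E R^o))
    (is_diff_id (mu : clin E R^o)).
  have := is_diff_comp dp (differentiableP dH).
  by rewrite (_ : Hloc \o _ = (fun nu => H (g, nu)))// /Hloc; apply/funext => nu /=;
    rewrite chartK.
have e1 : pairing (partial_g H g mu) w = 'd Hloc (phi g g, mu) (w, 0).
  rewrite (to_dualE (f := 'd (fun x => Hloc (x, mu)) (phi g g))).
  - by have [_ ->] := d1.
  - exact: linearP.
  - by have [d _] := d1; exact: diff_continuous.
have e2 : pairing (differential (model_atlas (dual g_)) (fun nu => H (g, nu)) mu) tau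
    = 'd Hloc (phi g g, mu) (0, tau).
  rewrite (to_dualE (f := 'd (fun nu : clin E R^o => H (g, nu) : R^o) (mu : clin E R^o))).
  - by have [_ ->] := d2.
  - exact: linearP.
  - by have [d _] := d2; exact: diff_continuous.
rewrite e1 e2 -linearD.
rewrite (to_dualE (f := 'd Hloc (phi g g, mu : clin E R^o))).
- by congr ('d Hloc _ _); rewrite -[RHS]/(w + 0, 0 + tau) addr0 add0r.
- exact: linearP.
- exact: diff_continuous.
Qed.

Lemma is_derive_linear (F K : normedModType R) (L : {linear F -> K}) (c : R -> F)
    (t : R) (v : F) : continuous L ->
  is_derive (t : R^o) (1 : R^o) (c : R^o -> F) v ->
  is_derive (t : R^o) (1 : R^o) (L \o c : R^o -> K) (L v).
Proof.
move=> cL [/derivable1_diffP dc vE].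
have dL : is_diff (c t) L L.
  by split; [exact: linear_differentiable|exact: diff_lin].
have [dLc dLcE] := is_diff_comp (differentiableP dc) dL.
split; first exact: diff_derivable.
by rewrite deriveE// dLcE /= -deriveE// vE.
Qed.

Lemma has_velocity_pair (F K : normedModType R) (M N : topologicalType)
    (C : atlas F M) (D : atlas K N) (c : R -> M * N) (t : R) (v : F) (w : K) :
  has_velocity (prod_atlas C D) c t (v, w) ->
  has_velocity C (fst \o c) t v /\ has_velocity D (snd \o c) t w.
Proof.
move=> [cc dc]; split; split.
- by apply: (@continuous_comp _ _ _ c (@fst M N) t cc); exact: cvg_fst.
- pose L : {linear (F * K)%type -> F} := fst.
  by apply: (is_derive_linear (L := L) _ dc) => z; exact: cvg_fst.
- by apply: (@continuous_comp _ _ _ c (@snd M N) t cc); exact: cvg_snd.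
- pose L : {linear (F * K)%type -> K} := snd.
  by apply: (is_derive_linear (L := L) _ dc) => z; exact: cvg_snd.
Qed.

Lemma hamiltonian_fieldE (Omega : two_form (triv_atlas G))
    (Omega_pushforward :
      is_pushforward (right_triv G) (canonical_form (@lie_atlas R E G)) Omega)
    (H : G * dual g_ -> R)
    (H_smooth : smooth_map (triv_atlas G) (model_atlas R^o) H)
    (X : vector_field (triv_atlas G)) (X_hamiltonian : is_hamiltonian Omega H X)
    (g_reflexive : reflexive_space g_) (g : G) (mu : dual g_) :
  let xi := partial_mu H g mu in
  X (g, mu) = (TeR g xi, ad_star xi mu - TeR_dual (partial_g H g mu)).
Proof.
have [Bi BiK BK] := TeR_bijective g.
case XE : (X (g, mu)) => [v sigma] xi0; rewrite {}/xi0.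
pose xi : g_ := Bi v; have vE : v = TeR g xi by rewrite BK.
have eqn (eta : g_) (tau : dual g_) :
    pairing sigma eta - pairing tau xi - pairing mu (lie_bracket xi eta) =
    - (pairing (partial_g H g mu) (TeR g eta) +
     pairing (differential (model_atlas (dual g_)) (fun nu => H (g, nu)) mu) tau).
  rewrite -differential_triv// -X_hamiltonian XE vE.
  by rewrite (symplectic_formE Omega_pushforward).
(* Test vectors (0, tau). *)
have xiE : partial_mu H g mu = xi.
  apply: of_bidual_eq => // tau; have := eqn 0 tau.
  have -> : lie_bracket xi 0 = 0 by have [L <-] := lie_bracket_clin xi; exact: linear0.
  have -> : TeR g 0 = 0 by rewrite TeRE linear0.
  by rewrite !pairing0r sub0r subr0 add0r => /oppr_inj.
rewrite xiE -vE; congr pair.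
apply: (@clinP R E R^o) => eta.
rewrite -[RHS]/(pairing (ad_star xi mu) eta - pairing (TeR_dual (partial_g H g mu)) eta).
rewrite ad_starE pairing_TeR_dual addrC.
(* Test vectors (T_e R_g eta, 0). *)
have := eqn eta 0; rewrite pairing0l subr0 pairing0r addr0.
by move=> /(canRL (subrK _)).
Qed.

End Hamiltonian.

Theorem mainTheorem2 (R : realType) (E : completeNormedModType R)
    (G : lieGroupType E) (g_reflexive : reflexive_space (lie_algebra G))
    (Omega : two_form (triv_atlas G))
    (Omega_pushforward :
      is_pushforward (right_triv G) (canonical_form (@lie_atlas R E G)) Omega)
    (H : G * dual (lie_algebra G) -> R)
    (H_smooth : smooth_map (triv_atlas G) (model_atlas R^o) H)
    (X : vector_field (triv_atlas G))
    (X_hamiltonian : is_hamiltonian Omega H X) :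
  (forall (g : G) (mu : dual (lie_algebra G)),
    let xi := partial_mu H g mu in
    let nu := - TeR_dual (partial_g H g mu) in
    X (g, mu) = triv_right_inv_field xi nu (g, mu) /\
    X (g, mu) = (TeR g xi, ad_star xi mu - TeR_dual (partial_g H g mu))) /\
  (forall (c : R -> G * dual (lie_algebra G)) (t : R),
    has_velocity (triv_atlas G) c t (X (c t)) ->
    let g := (c t).1 in
    let mu := (c t).2 in
    let xi := partial_mu H g mu in
    has_velocity (@lie_atlas R E G) (fst \o c) t (TeR g xi) /\
    has_velocity (model_atlas (dual (lie_algebra G))) (snd \o c) t
      (ad_star xi mu - TeR_dual (partial_g H g mu))).
Proof.
have XE := hamiltonian_fieldE Omega_pushforward H_smooth X_hamiltonian g_reflexive.
split=> [g mu xi nu|c t ct g mu xi].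
  by rewrite XE /triv_right_inv_field addrC.
by apply: has_velocity_pair; rewrite -XE /g /mu -surjective_pairing.
Qed.
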